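(* Let $d\ge 2$, $q\ge 2$, and let $\mathbb{P}$ be a translation-invariant probability measure on $\Omega=\{0,1,\dots,q-1\}^{\mathbb{Z}^d}$. Let $r\ge 1$ be an integer and let $P$ and $P'$ be two distinct patterns of diameter $r$ such that $\mathbb{P}(\Box P')>0$. Suppose that $\mathbb{P}$ satisfies the boundary-$1$ Markov property, and that the cluster-size distribution has an exponential tail with limit $\mu\in(0,1]$. Let $$\gamma_{PP'}=\frac{\mu^{c_{P'}}\,\mathbb{P}(\Box P)}{\mu^{c_P}\,\mathbb{P}(\Box P')}.$$ Then for all $\epsilon>0$, $$\limsup_{n\to\infty}\big[\mathbb{P}_n(|N_P-\gamma_{PP'}N_{P'}|\ge\epsilon n)\big]^{1/n}<1.$$
   Context: Setting: $S=\{0,1,\dots,q-1\}$, $\Omega=S^{\mathbb{Z}^d}$. Boundary-$s$ Markov property ($s\in S$): for finite $V\subset\mathbb{Z}^d$ let $N_V=\bigcup_{x\in V}(N_x\setminus V)$, where $N_x=\{y\in\mathbb{Z}^d:|y-x|=1\}$. $\mathbb{P}$ has the boundary-$s$ Markov property if for every finite $V\subset\mathbb{Z}^d$, given that all sites of $N_V$ are in the state $s$, the configuration on $V$ is conditionally independent of the configuration on $\mathbb{Z}^d\setminus(V\cup N_V)$. Clusters: a site $x$ is occupied if $\omega(x)=1$. $C(x)$ is the set of occupied sites that can be connected to $x$ by a nearest-neighbour path in $\mathbb{Z}^d$ passing only through occupied sites; $C(x)=\varnothing$ if $\omega(x)\ne 1$. $C=C(0)$, and $|X|$ is the number of sites of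 $X$. Exponential tail: the limit $\mu=\lim_{n\to\infty}[\mathbb{P}(|C|=n)]^{1/n}=\lim_{n\to\infty}[\mathbb{P}(n\le|C|<\infty)]^{1/n}$ exists for some $0<\mu\le 1$ (both limits exist and are equal). Conditional measure: $\mathbb{P}_n(\cdot)=\mathbb{P}(\cdot\mid |C|=n)$. Patterns: $Q=\{x\in\mathbb{Z}^d:0\le x_i<r\ \forall i\}$, $\overline{Q}=\{x\in\mathbb{Z}^d:-1\le x_i<r+1\ \forall i\}$, $\partial Q=\overline{Q}\setminus Q$, $Q_x=x+Q$, $\partial Q_x=x+\partial Q$. A pattern of diameter $r$ is an element $P=(P(x):x\in Q)$ of $S^Q$. $P$ occurs at $x$ if $\omega(x+y)=P(y)$ for all $y\in Q$; $P$ occurs at $x$ on $C$ if moreover $\partial Q_x\subset C$. $N_P=N_P(\omega)$ is the number of sites $x$ of the grid $(r+2)\mathbb{Z}^d+(1,1,\dots,1)$ such that $P$ occurs at $x$ on $C$. $c_P$ is the number of occupied sites in the pattern $P$ which are part of the cluster of the origin whenever $P$ occurs on $C$ at some site, i.e. the number of $y\in Q$ with $P(y)=1$ that are connected to $\partial Q$ by a nearest-neighbour path whose sites in $Q$ are all in state $1$ under $P$. $\mathbb{P}(\Box P)=\mathbb{P}(\omega(x)=P(x)\ \forall x\in Q,\ \omega(x)=1\ \forall x\in\partial Q)$. *)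

(* Defs.v *)
From HB Require Import structures.
From mathcomp Require Import all_boot all_order all_algebra finmap.
From mathcomp Require Import all_classical all_reals all_analysis.

Set Implicit Arguments.
Unset Strict Implicit.
Unset Printing Implicit Defensive.

Import Order.TTheory GRing.Theory Num.Theory.
Import numFieldNormedType.Exports.

Local Open Scope card_scope.
Local Open Scope fset_scope.
Local Open Scope classical_set_scope.
Local Open Scope ring_scope.

Notation site d := 'rV[int]_d (only parsing).

(* The proof that q >= 2 is a parameter of the type only because a
   measurableType must be pointed. *)
Definition state (q : nat) (hq : (2 <= q)%N) : Type := 'I_q.

HB.instance Definition _ (q : nat) (hq : (2 <= q)%N) := Finite.on (state hq).
HB.instance Definition _ (q : nat) (hq : (2 <= q)%N) :=
  isPointed.Build (state hq) (Ordinal hq).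

Definition one_state (q : nat) (hq : (2 <= q)%N) : state hq := Ordinal hq.

Definition config (d q : nat) (hq : (2 <= q)%N) : Type := site d -> state hq.

Section Percolation.
Context (d q : nat) (hq : (2 <= q)%N).

Definition coord_events (W : set (site d)) : set (set (config d hq)) :=
  [set E | exists2 x : site d, W x &
           exists s : state hq, E = [set w | w x = s]].

(* The events depending only on the configuration on W. *)
Definition events_on (W : set (site d)) : set (set (config d hq)) :=
  <<s coord_events W >>.

(* Configuration space with the product sigma-algebra. *)
Definition Omega : Type := g_sigma_algebraType (coord_events setT).

(* The l^1 norm is written out: a norm of a row vector in the library would be
   the sup norm, which has diagonal neighbours. *)
Definition adj (x y : site d) : bool :=
  \sum_(i < d) `|y ord0 i - x ord0 i| == 1.

Definition nbhd_boundary (V : set (site d)) : set (site d) :=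
  [set y | ~ V y /\ exists2 x, V x & adj x y].

Definition shift_config (z : site d) (w : Omega) : Omega := fun x => w (x + z).

Definition occupied (w : Omega) (x : site d) : Prop := w x = one_state hq.

Definition occ_cluster (w : Omega) (x : site d) : set (site d) :=
  [set y | exists p : seq (site d),
    [/\ path adj x p, last x p = y
      & forall z, z \in x :: p -> occupied w z]].

Definition cluster_size_eq (n : nat) : set Omega :=
  [set w | occ_cluster w 0 #= `I_n].

Definition cluster_size_ge_fin (n : nat) : set Omega :=
  [set w | finite_set (occ_cluster w 0) /\ `I_n #<= occ_cluster w 0].

Definition box (r : nat) : set (site d) :=
  [set x | forall i, 0 <= x ord0 i < r%:Z].

Definition box_closure (r : nat) : set (site d) :=
  [set x | forall i, -1 <= x ord0 i < r%:Z + 1].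

Definition box_boundary (r : nat) : set (site d) := box_closure r `\` box r.

Definition pattern (r : nat) : Type := box r -> state hq.

Definition occurs (r : nat) (p : pattern r) (w : Omega) (x : site d) : Prop :=
  forall y : box r, w (x + val y) = p y.

Definition occurs_on_cluster (r : nat) (p : pattern r) (w : Omega)
    (x : site d) : Prop :=
  occurs p w x /\ forall y, box_boundary r y -> occ_cluster w 0 (x + y).

Definition grid (r : nat) : set (site d) :=
  [set x | exists z : site d, x = z *+ (r + 2) + const_mx 1].

(* N_P. The value of fset_set on an infinite set is empty; this only concerns
   infinite clusters. *)
Definition num_occ (r : nat) (p : pattern r) (w : Omega) : nat :=
  #|` fset_set [set x | grid r x /\ occurs_on_cluster p w x]|.

(* c_P *)
Definition num_attached (r : nat) (p : pattern r) : nat :=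
  #|` fset_set [set y : box r | p y = one_state hq /\
        exists t : seq (site d),
          [/\ path adj (val y) t, box_boundary r (last (val y) t)
            & forall z : box r, val z \in val y :: t -> p z = one_state hq]]|.

(* The event written with a box before the pattern in P(box P). *)
Definition boxed_event (r : nat) (p : pattern r) : set Omega :=
  [set w | (forall y : box r, w (val y) = p y) /\
           (forall x, box_boundary r x -> w x = one_state hq)].

Section Measure.
Context (R : realType) (P : probability Omega R).

(* Conditional probability; equal to 0 when the conditioning event is null. *)
Definition condprob (A B : set Omega) : R :=
  fine (P (A `&` B)) / fine (P B).

Definition translation_invariant : Prop :=
  forall (z : site d) (A : set Omega), measurable A ->
    P (shift_config z @^-1` A) = P A.

Definition boundary_markov (s : state hq) : Prop :=
  forall V : set (site d), finite_set V ->
  let B : set Omega := [set w | forall y, nbhd_boundary V y -> w y = s] in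
  forall A A' : set Omega,
    events_on V A -> events_on (~` (V `|` nbhd_boundary V)) A' ->
    condprob (A `&` A') B = condprob A B * condprob A' B.

Definition exponential_tail (mu : R) : Prop :=
  [/\ 0 < mu <= 1,
      (fun n : nat => fine (P (cluster_size_eq n)) `^ n%:R^-1) @ \oo --> mu
    & (fun n : nat => fine (P (cluster_size_ge_fin n)) `^ n%:R^-1) @ \oo --> mu].

Definition gamma_ratio (mu : R) (r : nat) (p p' : pattern r) : R :=
  (mu ^+ num_attached p' * fine (P (boxed_event p))) /
  (mu ^+ num_attached p * fine (P (boxed_event p'))).

End Measure.
End Percolation.

(* Main.v *)
Require Import Defs.
From mathcomp Require Import all_boot all_order all_algebra.
From mathcomp Require Import all_classical all_reals all_analysis.
From mathcomp Require Import measurable_realfun finmap zify ring lra.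
Import Order.TTheory GRing.Theory Num.Theory.
Import numFieldNormedType.Exports.
Local Open Scope classical_set_scope.
Local Open Scope ring_scope.
Set Implicit Arguments.
Unset Strict Implicit.
Unset Printing Implicit Defensive.

(** Replacing the pattern in one box [x + Q] whose boundary lies in the cluster
    has a completely predictable effect.  The boundary of a box is connected
    when [d >= 2], and the origin lies in no box of the grid, so the part of the
    cluster outside the box is the same before and after
    ([cluster_outside]); inside the box the cluster consists of the attached
    sites of the pattern ([cluster_inside]).  Hence turning [p'] into [p] changes
    the size of the cluster by [c_p - c_p'], adds one to [N_p] and removes one
    from [N_p'] ([joint_event_swap]).  By the boundary Markov property it
    multiplies probabilities by [P(box p) / P(box p')] ([box_swap]).

    Write [a n k l] for the probability of [|C| = n, N_p = k, N_p' = l], and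
    [b], [b'] for the probabilities of the two boxed patterns.  Counting pairs
    of a configuration and a place at which to swap, in two ways, gives the exact
    identity of [joint_prob_swap]:

      [(l + 1) * a (n + c_p') k (l + 1) * b = (k + 1) * a (n + c_p) (k + 1) l * b'].

    Iterating it [m] times expresses [a n k l] through
    [a (n - m c_p' + m c_p) (k + m) (l - m)], with a factor of at most
    [((k + m) b' / ((l - m) b)) ^ m].  The last probability is at most
    [P(|C| = n - m c_p' + m c_p)], which is [mu ^ (n - m c_p' + m c_p)] up to a
    subexponential factor; as [mu ^ n] is [P(|C| = n)] up to such a factor, the
    conditional probability of [N_p = k, N_p' = l] given [|C| = n] is at most
    [((k + m) / (gamma * (l - m))) ^ m] up to a subexponential factor.  If
    [k + eps n <= gamma l] and [m] is a small multiple of [n], the base is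
    bounded away from 1, which makes the bound exponentially small
    ([one_sided_tail]).  The opposite deviation is the same statement with the
    two patterns exchanged, which replaces [gamma] by its inverse
    ([joint_two_sided_tail]).  Both counts are at most [n], as the lowest
    corners of the boxes involved are distinct sites of the cluster, so a union
    bound over the pairs [(k, l)] costs only a factor [(n + 1) ^ 2]. *)

(** * Boxes and their boundaries in the lattice *)

Section Lattice.
Context (d : nat).
Implicit Types (x y z u v : 'rV[int]_d).

Lemma adj_sym x y : adj x y = adj y x.
Proof. by rewrite /adj; congr (_ == _); apply: eq_bigr => i _; rewrite distrC. Qed.

Lemma adj_addl z x y : adj (z + x) (z + y) = adj x y.
Proof.
rewrite /adj; congr (_ == _); apply: eq_bigr => i _; rewrite !mxE.
by congr (`|_|); ring.
Qed.

Lemma adj_coord x y i : adj x y -> `|y ord0 i - x ord0 i| <= 1.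
Proof.
move=> /eqP <-; rewrite (bigD1 i) //= lerDl.
by apply: sumr_ge0.
Qed.

Lemma adj_decr x (j : 'I_d) : adj x (x - delta_mx ord0 j).
Proof.
apply/eqP; rewrite (bigD1 j) //= !mxE !eqxx /= big1 => [|i ij].
  by rewrite addr0 addrAC subrr add0r normrN normr1.
by rewrite !mxE eqxx (negbTE ij) /= subr0 subrr normr0.
Qed.

Lemma box_boundary_adj (r : nat) u v :
  box r u -> adj u v -> ~ box r v -> box_boundary r v.
Proof.
move=> Qu uv nQv; split=> // i; have := adj_coord i uv; have := Qu i; lia.
Qed.

Lemma adj_box_boundary (r : nat) u v :
  ~ box r u -> adj u v -> box r v -> box_boundary r u.
Proof. by rewrite adj_sym => nQ uv Qv; apply: box_boundary_adj Qv uv nQ. Qed.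

Lemma box_boundaryP (r : nat) u : box_boundary r u <->
  box_closure r u /\ exists i, u ord0 i = -1 \/ u ord0 i = r%:Z.
Proof.
split=> -[Cu Bu]; split=> //.
  apply: contrapT => Nu; apply: Bu => i; have := Cu i.
  case: (eqVneq (u ord0 i) (-1)) => [e|/eqP n1]; first by case: Nu; exists i; left.
  case: (eqVneq (u ord0 i) r%:Z) => [e|/eqP n2]; first by case: Nu; exists i; right.
  lia.
by move=> Qu; case: Bu => i Hi; have := Qu i; lia.
Qed.

Let corner : 'rV[int]_d := const_mx (-1).

Lemma box_boundary_corner (r : nat) : (0 < d)%N -> box_boundary r corner.
Proof.
move=> d0; apply/box_boundaryP; split; last by exists (Ordinal d0); left; rewrite mxE.
by move=> i; rewrite mxE; lia.
Qed.

(** The boundary retracts to its lowest corner by unit steps.  A coordinate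
    equal to [-1] or [r] keeps a site on the boundary whatever the others do, so
    the others can be lowered first; once they are all [-1], any one of them
    keeps the site on the boundary while the remaining coordinate is lowered.
    A second coordinate is needed for this last step: for [d = 1] the boundary
    has two components. *)
Lemma box_boundary_descend (r : nat) u : (1 < d)%N -> box_boundary r u ->
  u = corner \/ exists2 j, box_boundary r (u - delta_mx ord0 j) & -1 < u ord0 j.
Proof.
move=> d1 /box_boundaryP[Cu [i Hi]].
have Cd j : -1 < u ord0 j -> box_closure r (u - delta_mx ord0 j).
  move=> uj k; rewrite !mxE eqxx /=; have := Cu k.
  by case: eqVneq => [->|_]; rewrite ?mulr1n ?mulr0n; lia.
have [[j ji uj]|Nj] := pselect (exists2 j, j != i & -1 < u ord0 j).
  right; exists j => //; apply/box_boundaryP; split; first exact: Cd.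
  by exists i; rewrite !mxE eqxx /= eq_sym (negbTE ji) /= subr0.
have Hj j : j != i -> u ord0 j = -1.
  move=> ji; have := Cu j; case: (ltP (-1) (u ord0 j)) => [uj|]; last by lia.
  by case: Nj; exists j.
have [ui|ui] := ltP (-1) (u ord0 i); last first.
  left; apply/rowP => j; rewrite mxE; case: (eqVneq j i) => [->|/Hj//].
  (* stated with ord0, since rowP introduces the row index as 0 *)
  by suff: u ord0 i = -1 by []; have := Cu i; lia.
right; exists i => //; apply/box_boundaryP; split; first exact: Cd.
have [j ji] : exists j : 'I_d, j != i.
  have d0 : (0 < d)%N by lia.
  case: (eqVneq i (Ordinal d0)) => [->|ni]; last by exists (Ordinal d0); rewrite eq_sym.
  by exists (Ordinal d1).
by exists j; left; rewrite !mxE eqxx /= (negbTE ji) subr0 Hj.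
Qed.

(** Every boundary site descends to the same corner, so a property that is
    transmitted between adjacent boundary sites holds everywhere or nowhere. *)
Lemma box_boundary_connected (r : nat) (Z : set 'rV[int]_d) u v : (1 < d)%N ->
  (forall a b, box_boundary r a -> box_boundary r b -> adj a b -> Z a -> Z b) ->
  box_boundary r u -> box_boundary r v -> Z u -> Z v.
Proof.
move=> d1 Zadj.
suff H a : box_boundary r a -> (Z a <-> Z corner) by move=> /H-> /H->.
pose height (x : 'rV[int]_d) : int := \sum_(k < d) (x ord0 k + 1).
have [n] := ubnP `|height a|%N.
elim: n => // n IH in a *; rewrite ltnS => an Ba.
have [->//|[j Bj aj]] := box_boundary_descend d1 Ba.
have /IH/(_ Bj)<- : (`|height (a - delta_mx ord0 j)%R| < n)%N.
  apply: leq_trans an.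
  have E : height a = height (a - delta_mx ord0 j) + 1.
    rewrite /height (bigD1 j) //= [in RHS](bigD1 j) //= !mxE !eqxx /=.
    rewrite [in RHS](eq_bigr (fun k => a ord0 k + 1)); last first.
      by move=> k kj; rewrite !mxE eqxx (negbTE kj) /= subr0.
    ring.
  have : 0 <= height (a - delta_mx ord0 j).
    apply: sumr_ge0 => k _; have [+ _] := Bj.
    by move=> /(_ k)/andP[+ _]; rewrite -lerBlDr sub0r.
  by move: E; move: (height _) (height _) => s t; lia.
have aj' := adj_decr a j.
by split; apply: Zadj; rewrite // adj_sym.
Qed.

Lemma grid_coord (r : nat) x : grid r x ->
  exists z, forall i, x ord0 i = z ord0 i * (r%:Z + 2) + 1.
Proof.
by move=> [z ->]; exists z => i; rewrite !mxE mulmxnE -[_ *+ (_ + _)]mulr_natr natrD natz.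
Qed.

(** The shift of the grid by [(1, ..., 1)] puts the origin in the boundary of a
    box.  Changing the pattern in a box thus never changes the state of the
    origin. *)
Lemma origin_notin_grid_box (r : nat) x : (0 < d)%N -> grid r x -> ~ box r (0 - x).
Proof.
move=> d0 /grid_coord[z zE] /(_ (Ordinal d0)); rewrite !mxE zE.
case: (ltP (z ord0 (Ordinal d0)) 0) => z0; nia.
Qed.

(** The mesh of the grid is the side of an enlarged box, so that the enlarged
    boxes tile the lattice. *)
Lemma grid_box_disjoint (r : nat) x z u : grid r x -> grid r z -> x != z ->
  box_closure r (u - z) -> ~ box_closure r (u - x).
Proof.
move=> /grid_coord[x' xE] /grid_coord[z' zE] /eqP xz uz ux.
have [i /eqP nx] : exists i, x' ord0 i <> z' ord0 i.
  apply: contrapT => H; apply: xz; apply/rowP => i.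
  suff: x ord0 i = z ord0 i by [].
  by rewrite xE zE; congr (_ * _ + _); apply: contrapT => e; apply: H; exists i.
move: uz ux => /(_ i) uz /(_ i) ux.
move: uz ux; rewrite !mxE xE zE.
have [lt|lt|/eqP] := ltrgtP (x' ord0 i) (z' ord0 i); last by rewrite (negbTE nx).
- nia.
- nia.
Qed.

End Lattice.

(** * The cluster of the origin near a box *)

Section Clusters.
Context (d q : nat) (hq : (2 <= q)%N).
Implicit Types (x y z u v : 'rV[int]_d) (w : Omega d hq).

Lemma cluster_occ w x y : occ_cluster w x y -> occupied w y.
Proof. by move=> [s [_ <- H]]; apply: H; rewrite mem_last. Qed.

Lemma cluster_base w x : occupied w x -> occ_cluster w x x.
Proof. by move=> wx; exists [::]; split=> // z; rewrite mem_seq1 => /eqP->. Qed.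

Lemma cluster_step w x y z :
  occ_cluster w x y -> adj y z -> occupied w z -> occ_cluster w x z.
Proof.
move=> [s [xs sy sw]] yz wz; exists (rcons s z); split.
- by rewrite rcons_path xs sy.
- by rewrite last_rcons.
- by move=> u; rewrite -rcons_cons mem_rcons inE => /predU1P[->//|/sw].
Qed.

(** The cluster is the smallest set that contains its base point and is closed
    under occupied neighbours; in this form statements about clusters need no
    surgery on paths. *)
Lemma cluster_ind w x (Z : set 'rV[int]_d) :
  (occupied w x -> Z x) ->
  (forall u v, occ_cluster w x u -> Z u -> adj u v -> occupied w v -> Z v) ->
  occ_cluster w x `<=` Z.
Proof.
move=> Zx Zstep y [s]; elim/last_ind: s y => [|s z IH] y [] /=.
  by move=> _ <- H; apply/Zx/H; rewrite mem_head.
rewrite rcons_path last_rcons => /andP[xs sz] <- sw.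
have sw' u : u \in x :: s -> occupied w u.
  by move=> us; apply: sw; rewrite -rcons_cons mem_rcons inE us orbT.
apply: Zstep sz _; [by exists s| |].
- by apply: IH; split.
- by apply: sw; rewrite -rcons_cons mem_rcons mem_head.
Qed.

Variable r : nat.

Definition boundary_in_cluster w x : Prop :=
  forall y, box_boundary r y -> occ_cluster w 0 (x + y).

Definition agree_off_box x w w' : Prop := forall z, ~ box r (z - x) -> w z = w' z.

Definition attached (p : pattern d hq r) : set (box r) :=
  [set y | p y = one_state hq /\
        exists t : seq 'rV[int]_d,
          [/\ path (@adj d) (val y) t, box_boundary r (last (val y) t)
            & forall z : box r, val z \in val y :: t -> p z = one_state hq]].

Lemma adj_subl x u v : adj (u - x) (v - x) = adj u v.
Proof. by rewrite ![_ - x]addrC adj_addl. Qed.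

Hypothesis d1 : (1 < d)%N.

(** A path in the cluster that enters the box must pass through the boundary,
    which is occupied and connected, so that the excursion can be replaced by a
    detour along the boundary.  The induction along the path keeps, inside the
    box, the information that the whole boundary already belongs to the cluster
    of [w']. *)
Lemma cluster_outside x w w' y : grid r x -> agree_off_box x w w' ->
  boundary_in_cluster w x -> ~ box r (y - x) ->
  occ_cluster w 0 y -> occ_cluster w' 0 y.
Proof.
move=> gx ww' Bw nQy Cy.
have nQ0 := origin_notin_grid_box (ltnW d1) gx.
pose Z u := if pselect (box r (u - x)) then boundary_in_cluster w' x
            else occ_cluster w' 0 u.
suff: Z y by rewrite /Z; case: pselect.
have Bocc z : box_boundary r z -> occupied w' (x + z).
  move=> Bz; rewrite /occupied -ww'; first exact: cluster_occ (Bw _ Bz).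
  by rewrite [x + z]addrC addrK; case: Bz.
move: Cy; apply: cluster_ind => [w0|u v Cu + uv wv]; rewrite /Z.
  by case: pselect => // Q0; apply: cluster_base; rewrite /occupied -ww'.
case: pselect => Qu; case: pselect => Qv //= Zu.
  (* leaving the box: the exit site is on the boundary *)
- rewrite /= -(subrKC x v); apply: Zu.
  by apply: box_boundary_adj Qu _ Qv; rewrite adj_subl.
  (* entering the box: the entry site is on the boundary, which is connected *)
- have Bu : box_boundary r (u - x).
    by apply: adj_box_boundary Qu _ Qv; rewrite adj_subl.
  move=> z Bz; have := @box_boundary_connected d r (fun a => occ_cluster w' 0 (x + a))
    (u - x) z d1 _ Bu Bz; rewrite subrKC; apply=> //.
  move=> a b Ba Bb ab Ca; apply: cluster_step Ca _ _; rewrite ?adj_addl //.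
  exact: Bocc.
- by apply: cluster_step Zu uv _; rewrite /occupied -ww'.
Qed.

Lemma boundary_in_cluster_agree x w w' : grid r x -> agree_off_box x w w' ->
  boundary_in_cluster w x -> boundary_in_cluster w' x.
Proof.
move=> gx ww' Bw y By; apply: (cluster_outside gx ww' Bw _ (Bw _ By)).
by rewrite [x + y]addrC addrK; case: By.
Qed.

(** A site of the box is reached from the origin through the boundary, and the
    last stretch inside the box only sees the pattern. *)
Lemma cluster_inside x w (p : pattern d hq r) (y : box r) : grid r x ->
  boundary_in_cluster w x -> occurs p w x ->
  occ_cluster w 0 (x + val y) <-> attached p y.
Proof.
move=> gx Bw px; split; last first.
  move=> [py [t [yt Bt tp]]].
  have Qy : box r (val y) by exact: set_mem (valP y).
  move: (val y) Qy yt Bt tp => a {y py}; elim: t a => [|b t IH] a Qa /=.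
    by move=> _ Ba; have [_ /(_ Qa)] := Ba.
  move=> /andP[ab bt] Bt tp.
  apply: (@cluster_step _ _ (x + b)); last first.
  - rewrite /occupied.
    pose a' : box r := exist _ a (mem_set Qa).
    have -> : x + a = x + val a' by [].
    by rewrite px; apply: tp; rewrite mem_head.
  - by rewrite adj_addl adj_sym.
  have [Qb|nQb] := pselect (box r b); last first.
    by apply: Bw; apply: box_boundary_adj Qa ab nQb.
  by apply: IH => // z zb; apply: tp; rewrite inE zb orbT.
(* walking along the cluster, sites outside the box carry no information *)
pose Z u := forall Qu : box r (u - x), attached p (exist _ (u - x) (mem_set Qu)).
suff H : occ_cluster w 0 `<=` Z.
  move=> /H; rewrite /Z => H'.
  have Qy : box r ((x + val y) - x).
    by rewrite [x + _]addrC addrK; exact: set_mem (valP y).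
  have := H' Qy; set y' := exist _ _ _; suff -> : y' = y by [].
  by apply: val_inj; rewrite /= [x + _]addrC addrK.
apply: cluster_ind => [_ Q0|u v Cu Zu uv wv Qv].
  by case: (origin_notin_grid_box (ltnW d1) gx).
have pv : p (exist _ (v - x) (mem_set Qv)) = one_state hq.
  by rewrite -px /= subrKC.
split=> //.
have [Qu|nQu] := pselect (box r (u - x)).
  have [_ [t [ut Bt tp]]] := Zu Qu; exists ((u - x) :: t); split=> //.
    by rewrite /= adj_subl adj_sym uv.
  move=> z; rewrite inE => /predU1P[|/tp//].
  by move=> e; rewrite -pv; congr p; apply: val_inj.
have Bu : box_boundary r (u - x).
  by apply: adj_box_boundary nQu _ (Qv); rewrite adj_subl.
exists [:: u - x]; split=> //; first by rewrite /= adj_subl adj_sym uv.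
move=> z; rewrite inE => /predU1P[|].
  by move=> e; rewrite -pv; congr p; apply: val_inj.
by rewrite mem_seq1 => /eqP e; case: nQu; rewrite -e; exact: set_mem (valP z).
Qed.

(** This is where [c_p] enters: of the sites counted by [|C|], those in the
    box depend on the pattern alone. *)
Lemma card_cluster_split x w (p : pattern d hq r) : grid r x ->
  boundary_in_cluster w x -> occurs p w x -> finite_set (occ_cluster w 0) ->
  #|` fset_set (occ_cluster w 0)| =
  (#|` fset_set (occ_cluster w 0 `&` [set z | ~ box r (z - x)%R])| + num_attached p)%N.
Proof.
move=> gx Bw px fC; rewrite -[num_attached p]/(#|` fset_set (attached p)|).
set D := _ `&` _; pose f (y : box r) : 'rV[int]_d := x + val y.
have fD : finite_set D by exact: finite_setIl.
have finj : injective f by move=> a b /addrI /val_inj.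
have E : occ_cluster w 0 = D `|` f @` attached p.
  apply/seteqP; split=> [u Cu|u [[]//|[y Ay <-]]]; last first.
    by apply/(cluster_inside y gx Bw px).
  have [Qu|nQu] := pselect (box r (u - x)); last by left.
  right; pose y : box r := exist _ (u - x) (mem_set Qu); exists y.
    by apply/(cluster_inside y gx Bw px); rewrite /= subrKC.
  by rewrite /f /= subrKC.
have fA : finite_set (attached p).
  apply: sub_finite_set (finite_preimage (f := f) (in2W finj) fC) => y Ay.
  by apply/(cluster_inside y gx Bw px).
have fI : finite_set (f @` attached p) by exact: finite_image.
rewrite {1}E fset_setU // cardfsU -fset_setI //.
rewrite (_ : D `&` _ = set0) ?fset_set0 ?cardfs0 ?subn0.
  by rewrite fset_set_image // card_imfset.
rewrite -subset0 => u [[_ /= nQ] [y _ yu]]; apply: nQ.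
by rewrite -yu /f [x + _]addrC addrK; exact: set_mem (valP y).
Qed.

End Clusters.

(** * Effect of changing the pattern in a box *)

Section Swap.
Context (d q : nat) (hq : (2 <= q)%N) (r : nat).
Implicit Types (x y z u v : 'rV[int]_d) (w : Omega d hq) (p : pattern d hq r).

Lemma card_eq_IP (T : choiceType) (A : set T) n :
  (A #= `I_n)%card <-> finite_set A /\ #|` fset_set A| = n.
Proof.
split=> [An|[[m Am] <-]]; last by rewrite (card_fset_set Am).
by split; [exists n|exact: card_fset_set].
Qed.

Lemma finite_box : finite_set (box r : set 'rV[int]_d).
Proof.
pose f (g : {ffun 'I_d -> 'I_r}) : 'rV[int]_d := \row_i (g i)%:Z.
apply: (@sub_finite_set _ _ (range f)) => [x Qx|]; last first.
  exact/finite_image/finite_finset.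
have lt i : (`|x ord0 i| < r)%N by have := Qx i; lia.
exists [ffun i => Ordinal (lt i)] => //; apply/rowP => i; rewrite mxE ffunE /=.
suff: (`|x ord0 i|%N)%:Z = x ord0 i by [].
by have := Qx i; lia.
Qed.

Definition positions p w : set 'rV[int]_d :=
  [set x | grid r x /\ occurs_on_cluster p w x].

Lemma agree_sym x w w' : agree_off_box r x w w' -> agree_off_box r x w' w.
Proof. by move=> H z /H. Qed.

Hypothesis d1 : (1 < d)%N.

(** A place where the pattern occurs on the cluster is marked by the lowest
    corner of its box boundary, which is a site of the cluster; hence there are at
    most [|C|] of them. *)
Lemma finite_positions p w : finite_set (occ_cluster w 0) ->
  finite_set (positions p w) /\ (num_occ p w <= #|` fset_set (occ_cluster w 0)|)%N.
Proof.
move=> fC; pose f x : 'rV[int]_d := x + const_mx (-1).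
have finj : injective f by move=> a b /addIr.
have fS : f @` positions p w `<=` occ_cluster w 0.
  move=> _ [x [gx [_ Bx]] <-]; apply: Bx; exact: box_boundary_corner (ltnW d1).
have fP : finite_set (positions p w).
  apply: sub_finite_set (finite_preimage (f := f) (in2W finj) fC) => x Sx.
  by apply: fS; exists x.
split=> //; rewrite /num_occ -[[set _ | _]]/(positions p w).
have <- : #|` fset_set (f @` positions p w)| = #|` fset_set (positions p w)|.
  by rewrite fset_set_image // card_imfset.
by apply: fsubset_leq_card; rewrite -fset_set_sub //; exact: finite_image.
Qed.

Lemma occurs_swap p x z w w' : grid r x -> grid r z -> x != z ->
  agree_off_box r x w w' -> boundary_in_cluster r w x ->
  occurs_on_cluster p w z -> occurs_on_cluster p w' z.
Proof.
move=> gx gz xz ww' Bx [pz Bz].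
have nQ y : box_closure r y -> ~ box r ((z + y) - x).
  move=> Qy Qy'; apply: (@grid_box_disjoint d r x z (z + y)) => //.
    by rewrite [z + y]addrC addrK.
  by move=> i; have := Qy' i; lia.
split=> [y|y By].
  rewrite -ww' //; apply: nQ => i; have := set_mem (valP y) i; lia.
by apply: (cluster_outside d1 gx ww' Bx _ (Bz _ By)); apply: nQ; case: By.
Qed.

Lemma positions_swap p p' x w w' : p <> p' -> grid r x ->
  agree_off_box r x w w' -> boundary_in_cluster r w x ->
  occurs p w x -> occurs p' w' x ->
  positions p w = x |` positions p w' /\ ~ positions p w' x.
Proof.
move=> pp' gx ww' Bx px px'.
have Bx' := boundary_in_cluster_agree d1 gx ww' Bx.
split; last first.
  by move=> [_ [qx _]]; apply: pp'; apply/funext => y; rewrite -px' -qx.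
apply/seteqP; split=> [z [gz oz]|z [->|[gz oz]]].
- have [xz|xz] := eqVneq x z; first by left.
  by right; split=> //; exact: (occurs_swap gx gz xz ww' Bx).
- by [].
- split=> //; have [<-//|xz] := eqVneq x z.
  exact: (occurs_swap gx gz xz (agree_sym ww') Bx').
Qed.

Definition joint_event p p' (n k l : nat) : set (Omega d hq) :=
  [set w | [/\ cluster_size_eq n w, num_occ p w = k & num_occ p' w = l]].

Lemma joint_event_sym p p' n k l : joint_event p p' n k l = joint_event p' p n l k.
Proof. by apply/seteqP; split=> w []. Qed.

Lemma num_occ_swap p p' x w w' : p <> p' -> grid r x ->
  agree_off_box r x w w' -> boundary_in_cluster r w x ->
  occurs p w x -> occurs p' w' x -> finite_set (occ_cluster w' 0) ->
  num_occ p w = (num_occ p w').+1.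
Proof.
move=> pp' gx ww' Bx px px' fC'.
have [E nx] := positions_swap pp' gx ww' Bx px px'.
have [fS _] := finite_positions p fC'.
rewrite /num_occ -[[set _ | _]]/(positions p w) E fset_setU1 // cardfsU1.
rewrite -[[set _ | _]]/(positions p w').
by rewrite in_fset_set // (memNset nx).
Qed.

(** The deterministic core of the proof: a swap moves a configuration from one
    cell of the joint partition by [(|C|, N_p, N_p')] to another.  The sizes are
    written [n + c_p'] and [n + c_p] so that no subtraction occurs. *)
Lemma joint_event_swap p p' x w w' n k l : p <> p' -> grid r x ->
  agree_off_box r x w w' -> boundary_in_cluster r w x ->
  occurs p w x -> occurs p' w' x ->
  joint_event p p' (n + num_attached p') k l.+1 w' ->
  joint_event p p' (n + num_attached p) k.+1 l w.
Proof.
move=> pp' gx ww' Bx px px' [/card_eq_IP [fC' cC'] kE lE].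
have Bx' := boundary_in_cluster_agree d1 gx ww' Bx.
have outE : occ_cluster w 0 `&` [set z | ~ box r (z - x)] =
            occ_cluster w' 0 `&` [set z | ~ box r (z - x)].
  apply/seteqP; split=> z [Cz Qz]; split=> //.
    exact: (cluster_outside d1 gx ww' Bx).
  exact: (cluster_outside d1 gx (agree_sym ww') Bx').
have fC : finite_set (occ_cluster w 0).
  pose f y : 'rV[int]_d := x + y.
  apply: (@sub_finite_set _ _
    ((occ_cluster w' 0 `&` [set z | ~ box r (z - x)]) `|` f @` box r)).
    move=> z Cz; have [Qz|nQz] := pselect (box r (z - x)); last by left; rewrite -outE.
    by right; exists (z - x) => //; exact: subrKC.
  by rewrite finite_setU; split; [exact: finite_setIl|exact/finite_image/finite_box].
split.
- apply/card_eq_IP; split=> //.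
  rewrite (card_cluster_split d1 gx Bx px fC) outE; congr (_ + _)%N.
  by have := card_cluster_split d1 gx Bx' px' fC'; rewrite cC' => /addIn.
- by rewrite -kE; exact: (num_occ_swap pp' gx ww' Bx px px').
- apply: succn_inj; rewrite -lE; apply/esym.
  by apply: (num_occ_swap (nesym pp') gx (agree_sym ww') Bx' px' px fC).
Qed.

End Swap.

(** * Measurability *)

Section CountableQuantifiers.
Context (disp : measure_display) (T : measurableType disp) (U : countType).
Implicit Types (D : U -> Prop) (F : U -> set T).

Lemma measurable_exists D F : (forall u, D u -> measurable (F u)) ->
  measurable [set w | exists2 u, D u & F u w].
Proof.
move=> mF; pose G u := if pselect (D u) then F u else set0.
rewrite (_ : [set w | _] = \bigcup_u G u); last first.
  apply/seteqP; split=> [w [u Du Fu]|w [u _]]; rewrite /G.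
    by exists u => //; case: pselect.
  by case: pselect => //= Du Fu; exists u.
apply: countable_bigcupT_measurable => [|u]; first exact: countableP.
by rewrite /G; case: pselect => //= Du; exact: mF.
Qed.

Lemma measurable_forall D F : (forall u, D u -> measurable (F u)) ->
  measurable [set w | forall u, D u -> F u w].
Proof.
move=> mF; rewrite (_ : [set w | _] = ~` [set w | exists2 u, D u & (~` F u) w]).
  by apply/measurableC/measurable_exists => u Du; exact/measurableC/mF.
apply/seteqP; split=> [w H [u Du]|w H u Du]; first by apply; exact: H.
by apply: contrapT => nF; apply: H; exists u.
Qed.

End CountableQuantifiers.

(** The random set takes countably many finite values, so conditions on its
    cardinality can be decomposed over these values. *)
Lemma measurable_finite_card (disp : measure_display) (T : measurableType disp)
    (U : countType) (S : T -> set U) (n : nat) :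
  (forall u, measurable [set w | S w u]) ->
  measurable [set w | finite_set (S w) /\ #|` fset_set (S w)| = n].
Proof.
move=> mS.
rewrite (_ : [set w | _] = [set w | exists2 F : {fset U}, #|` F| = n &
    forall u, True -> (if u \in F then S w u else ~ S w u)]).
  apply: measurable_exists => F _; apply: measurable_forall => u _.
  by case: (u \in F); [exact: mS|exact/measurableC/mS].
apply/seteqP; split=> [w [fS cS]|w [F cF SF]].
  exists (fset_set (S w)) => // u _; rewrite in_fset_set //.
  by case: ifPn => [/set_mem//|/negP nS Su]; exact: nS (mem_set Su).
have SE : S w = [set` F].
  by apply/seteqP; split=> u; have /= := SF u I; case: ifP.
by rewrite /= SE set_fsetK; split=> //; exact: finite_fset.
Qed.

Section Measurability.
Context (d q : nat) (hq : (2 <= q)%N) (r : nat).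
Implicit Types (x y z : 'rV[int]_d) (W : set 'rV[int]_d) (p : pattern d hq r).

Lemma events_on_site W x s : W x -> events_on W [set w : config d hq | w x = s].
Proof. by move=> Wx; apply: sub_gen_smallest; exists x => //; exists s. Qed.

Lemma events_on_forall W (D : 'rV[int]_d -> Prop) (f : 'rV[int]_d -> state hq) :
  D `<=` W -> events_on W [set w : config d hq | forall z, D z -> w z = f z].
Proof.
move=> DW.
apply: (@measurable_forall _ (g_sigma_algebraType (@coord_events d q hq W))
   _ D (fun z => [set w | w z = f z])) => z Dz.
by apply: events_on_site; exact: DW.
Qed.

Lemma measurable_site x s : measurable [set w : Omega d hq | w x = s].
Proof. exact: (@events_on_site setT). Qed.

Lemma measurable_cluster x y : measurable [set w : Omega d hq | occ_cluster w x y].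
Proof.
rewrite (_ : [set w | _] = [set w : Omega d hq | exists2 s : seq 'rV[int]_d,
    path (@adj d) x s /\ last x s = y &
    forall z, z \in x :: s -> occupied w z]).
  apply: measurable_exists => s _; apply: measurable_forall => z _.
  exact: measurable_site.
by apply/seteqP; split=> [w [s [? ? ?]]|w [s [? ?] ?]]; exists s.
Qed.

Lemma measurable_occurs p x : measurable [set w : Omega d hq | occurs p w x].
Proof.
rewrite (_ : [set w | _] = [set w : Omega d hq | forall y : box r, True ->
   w (x + val y) = p y]).
  by apply: measurable_forall => y _; exact: measurable_site.
by apply/seteqP; split=> w H y; [move=> _|]; apply: H.
Qed.

Lemma measurable_boundary_in_cluster x :
  measurable [set w : Omega d hq | boundary_in_cluster r w x].
Proof. by apply: measurable_forall => y _; exact: measurable_cluster. Qed.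

Lemma measurable_occurs_on_cluster p x :
  measurable [set w : Omega d hq | occurs_on_cluster p w x].
Proof.
apply: measurableI; first exact: measurable_occurs.
exact: measurable_boundary_in_cluster.
Qed.

Lemma measurable_positions p x :
  measurable [set w : Omega d hq | positions p w x].
Proof.
have [gx|ngx] := pselect (grid r x).
  rewrite (_ : [set w | _] = [set w | occurs_on_cluster p w x]).
    exact: measurable_occurs_on_cluster.
  by apply/seteqP; split=> [w []//|w]; split.
by rewrite (_ : [set w | _] = set0) // -subset0 => w [].
Qed.

Lemma measurable_cluster_size n : measurable (@cluster_size_eq d q hq n).
Proof.
rewrite (_ : cluster_size_eq n = [set w | finite_set (occ_cluster w 0) /\
   #|` fset_set (occ_cluster w 0)| = n]); last first.
  by apply/seteqP; split=> w /card_eq_IP.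
by apply: measurable_finite_card => y; exact: measurable_cluster.
Qed.

Hypothesis d1 : (1 < d)%N.

Lemma measurable_joint_event p p' n k l : measurable (joint_event p p' n k l).
Proof.
pose N (p0 : pattern d hq r) m := [set w : Omega d hq |
  finite_set (positions p0 w) /\ #|` fset_set (positions p0 w)| = m].
have mN p0 m : measurable (N p0 m).
  by apply: measurable_finite_card => x; exact: measurable_positions.
rewrite (_ : joint_event _ _ _ _ _ = cluster_size_eq n `&` (N p k `&` N p' l)).
  by apply: measurableI; [exact: measurable_cluster_size|exact: measurableI].
apply/seteqP; split=> w.
  move=> [Cn kE lE]; split=> //; have /card_eq_IP[fC _] := Cn.
  by split; (split; [exact: (finite_positions d1 _ fC).1|]).
by move=> [? [[_ ?] [_ ?]]].
Qed.

End Measurability.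

(** * Change of pattern under the Markov property *)

Section Overlay.
Context (d q : nat) (hq : (2 <= q)%N) (r : nat).
Implicit Types (x y z : 'rV[int]_d) (p : pattern d hq r) (w : Omega d hq).

Definition box_at x : set 'rV[int]_d := [set z | box r (z - x)].

Lemma box_atP x z : box_at x z -> exists y : box r, z = x + val y.
Proof. by move=> Qz; exists (exist _ (z - x) (mem_set Qz)); rewrite /= subrKC. Qed.

(** Forcing the pattern [p] in a box and ones on its neighbours.  The preimage
    of an event under this map is an event about the configuration away from the
    box, to which the Markov property applies. *)
Definition overlay p x w : Omega d hq := fun z =>
  if insub (z - x) is Some y then p y
  else if pselect (nbhd_boundary (box_at x) z) then one_state hq else w z.

Lemma overlay_in p x w (y : box r) : overlay p x w (x + val y) = p y.
Proof. by rewrite /overlay [x + _]addrC addrK valK. Qed.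

Lemma overlay_out p x w z : ~ box_at x z -> overlay p x w z =
  if pselect (nbhd_boundary (box_at x) z) then one_state hq else w z.
Proof.
by move=> nQ; rewrite /overlay insubF //; apply/negP => /set_mem.
Qed.

Lemma overlay_agree p p' x w : agree_off_box r x (overlay p x w) (overlay p' x w).
Proof. by move=> z nQ; rewrite !overlay_out. Qed.

Lemma overlay_occurs p x w : occurs p (overlay p x w) x.
Proof. by move=> y; rewrite overlay_in. Qed.

Lemma overlay_id p x w : occurs p w x ->
  (forall y, nbhd_boundary (box_at x) y -> w y = one_state hq) -> overlay p x w = w.
Proof.
move=> pw Bw; apply/funext => z.
have [Qz|nQz] := pselect (box_at x z).
  by have [y ->] := box_atP Qz; rewrite overlay_in pw.
by rewrite overlay_out //; case: pselect => //= /Bw ->.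
Qed.

(** At each site the overlaid configuration is either constant or equal to the
    original one, and the latter only happens away from the box and its
    neighbours. *)
Lemma overlay_preimage p x (E : set (Omega d hq)) : measurable E ->
  events_on (~` (box_at x `|` nbhd_boundary (box_at x))) (overlay p x @^-1` E).
Proof.
set W := ~` _; move=> mE.
pose T := g_sigma_algebraType (@coord_events d q hq W).
suff H : measurable_fun setT (overlay p x : T -> Omega d hq).
  by rewrite -[_ @^-1` _]setTI; exact: (H measurableT _ mE).
apply: (@measurability _ _ T (Omega d hq) setT (overlay p x)
  (@coord_events d q hq setT)) => // _ [_ [z _ [s ->]] <-].
rewrite setTI.
have [Wz|nWz] := pselect (W z).
  rewrite (_ : _ @^-1` _ = [set w : T | w z = s]); last first.
    apply/seteqP; rewrite /preimage; split=> w /=.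
      rewrite overlay_out; last by move=> Qz; apply: Wz; left.
      by case: pselect => // Nz _; case: Wz; right.
    move=> <-; rewrite overlay_out; last by move=> Qz; apply: Wz; left.
    by case: pselect => // Nz; case: Wz; right.
  exact: (@events_on_site d q hq W).
pose s0 := overlay p x (fun=> s) z.
have cst w : overlay p x w z = s0.
  rewrite /s0; have [Qz|nQz] := pselect (box_at x z).
    by have [y ->] := box_atP Qz; rewrite !overlay_in.
  rewrite !overlay_out //; case: pselect => // nN; case: nWz => -[//|//].
have [<-|ns] := pselect (s0 = s).
  by rewrite (_ : _ @^-1` _ = setT) //; apply/seteqP; split=> // w _; exact: cst.
rewrite (_ : _ @^-1` _ = set0) // -subset0 => w.
by rewrite /preimage /= cst.
Qed.

End Overlay.

Arguments overlay_agree {d q hq r} p p' x w.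

Lemma probability_fine_le (disp : measure_display) (T : measurableType disp)
    (R : realType) (P : probability T R) (A B : set T) :
  measurable A -> measurable B -> A `<=` B -> fine (P A) <= fine (P B).
Proof.
move=> mA mB AB; apply: fine_le; [exact: fin_num_measure|exact: fin_num_measure|].
by apply: le_measure => //; exact: mem_set.
Qed.

Section MarkovSwap.
Context (d q : nat) (hq : (2 <= q)%N) (r : nat) (R : realType).
Context (P : probability (Omega d hq) R).
Implicit Types (x y z : 'rV[int]_d) (p : pattern d hq r) (w : Omega d hq).

Hypothesis d1 : (1 < d)%N.
Hypothesis hinv : translation_invariant P.
Hypothesis hmarkov : boundary_markov P (one_state hq).

Let Pr (A : set (Omega d hq)) : R := fine (P A).

Let ones x : set (Omega d hq) :=
  [set w | forall y, nbhd_boundary (box_at r x) y -> w y = one_state hq].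

(** The neighbours of a box do not exhaust its boundary: [box_boundary] also
    contains the diagonal sites, such as the corners, whose states are part of the
    outer configuration in the Markov property. *)
Let corners x : set (Omega d hq) :=
  [set w | forall y, box_boundary r (y - x) /\ ~ nbhd_boundary (box_at r x) y ->
     w y = one_state hq].

Lemma nbhd_box_at x y : nbhd_boundary (box_at r x) y -> box_boundary r (y - x).
Proof.
move=> [nQy [z Qz zy]]; apply: box_boundary_adj Qz _ nQy.
by rewrite adj_subl.
Qed.

Lemma finite_box_at x : finite_set (box_at r x).
Proof.
apply: (@sub_finite_set _ _ ((fun y => x + y) @` box r)) => [z Qz|]; last first.
  exact/finite_image/finite_box.
by exists (z - x) => //; rewrite subrKC.
Qed.

Lemma measurable_boxed_event p : measurable (boxed_event p).
Proof.
rewrite (_ : boxed_event p = [set w | occurs p w 0] `&`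
    [set w | forall y, box_boundary r y -> w y = one_state hq]).
  apply: measurableI; first exact: measurable_occurs.
  by apply: measurable_forall => y _; exact: measurable_site.
by apply/seteqP; split=> w [H ?]; split=> // y; have := H y; rewrite add0r.
Qed.

Lemma boxed_event_translate p x :
  Pr (boxed_event p) = Pr ([set w | occurs p w x] `&` corners x `&` ones x).
Proof.
rewrite /Pr -(hinv x (measurable_boxed_event p)); congr (fine (P _)).
apply/seteqP; split=> w; rewrite /preimage /=.
  move=> [pw Bw]; split.
    split=> [y|y [By _]]; first by rewrite -pw /shift_config addrC.
    by rewrite -(Bw _ By) /shift_config subrK.
  by move=> y /nbhd_box_at By; rewrite -(Bw _ By) /shift_config subrK.
move=> [[pw Kw] Bw]; split=> [y|y By].
  by rewrite -pw /shift_config addrC.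
rewrite /shift_config.
have [Ny|nNy] := pselect (nbhd_boundary (box_at r x) (y + x)); first exact: Bw.
by apply: Kw; split=> //; rewrite addrK.
Qed.

Lemma measurable_ones x : measurable (ones x).
Proof. by apply: measurable_forall => y _; exact: measurable_site. Qed.

(** The Markov property for one box, with the denominators cleared. *)
Lemma markov_box x p (A : set (Omega d hq)) :
  events_on (~` (box_at r x `|` nbhd_boundary (box_at r x))) A ->
  Pr (ones x) != 0 ->
  Pr ([set w | occurs p w x] `&` A `&` ones x) * Pr (ones x) =
  Pr ([set w | occurs p w x] `&` ones x) * Pr (A `&` ones x).
Proof.
move=> eA B0.
have eO : events_on (box_at r x) [set w | occurs p w x].
  rewrite (_ : [set w | _] = [set w : config d hq | forall z, box_at r x z ->
      w z = overlay p x (fun=> one_state hq) z]).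
    by apply: events_on_forall.
  apply/seteqP; split=> w /= H.
    move=> z Qz; by have [y ->] := box_atP Qz; rewrite overlay_in H.
  move=> y; rewrite H ?overlay_in // /box_at /= [x + _]addrC addrK.
  exact: set_mem (valP y).
have := hmarkov (finite_box_at x) eO eA.
rewrite /condprob -/(ones x) -!/(Pr _) => H.
have := congr1 (fun t => t * Pr (ones x) ^+ 2) H; rewrite expr2.
rewrite mulrA divfK // => ->; field.
exact: B0.
Qed.

(** Given ones on the neighbours, the content of the box is independent of the
    outside, so exchanging [p'] for [p] multiplies the probability by the ratio
    of the conditional probabilities of [p] and [p'].  The same computation with
    the outer event [corners] identifies this ratio with
    [P(box p) / P(box p')]. *)
Lemma box_swap x p p' (A : set (Omega d hq)) :
  events_on (~` (box_at r x `|` nbhd_boundary (box_at r x))) A ->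
  0 < Pr (boxed_event p') ->
  Pr ([set w | occurs p' w x] `&` A `&` ones x) * Pr (boxed_event p) =
  Pr ([set w | occurs p w x] `&` A `&` ones x) * Pr (boxed_event p').
Proof.
move=> eA p'0.
have B0 : Pr (ones x) != 0.
  apply: contraTN p'0 => /eqP B0; rewrite -leNgt (boxed_event_translate p' x) -B0.
  apply: probability_fine_le => [||w []//]; last exact: measurable_ones.
  apply: measurableI; last exact: measurable_ones.
  apply: measurableI; first exact: measurable_occurs.
  by apply: measurable_forall => y _; exact: measurable_site.
have eK : events_on (~` (box_at r x `|` nbhd_boundary (box_at r x))) (corners x).
  apply: (@events_on_forall d q hq _ _ (fun=> one_state hq)) => y [By nNy] [Qy|//].
  by case: By.
rewrite (boxed_event_translate p x) (boxed_event_translate p' x).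
apply: (mulIf B0); apply: (mulIf B0).
have h1 := markov_box p' eA B0; have h2 := markov_box p eA B0.
have h3 := markov_box p eK B0; have h4 := markov_box p' eK B0.
transitivity ((Pr ([set w | occurs p' w x] `&` A `&` ones x) * Pr (ones x)) *
  (Pr ([set w | occurs p w x] `&` corners x `&` ones x) * Pr (ones x))).
  by ring.
rewrite h1 h3.
transitivity ((Pr ([set w | occurs p w x] `&` A `&` ones x) * Pr (ones x)) *
  (Pr ([set w | occurs p' w x] `&` corners x `&` ones x) * Pr (ones x))).
  by rewrite h2 h4; ring.
by ring.
Qed.

(** The cells before and after the swap have the same preimage under the two
    overlays, by [joint_event_swap]; they only differ in the content of the box,
    so [box_swap] compares their probabilities. *)
Lemma joint_event_occurs_swap p p' x n k l : p <> p' -> grid r x ->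
  0 < Pr (boxed_event p') ->
  Pr (joint_event p p' (n + num_attached p') k l.+1 `&`
      [set w | occurs_on_cluster p' w x]) * Pr (boxed_event p) =
  Pr (joint_event p p' (n + num_attached p) k.+1 l `&`
      [set w | occurs_on_cluster p w x]) * Pr (boxed_event p').
Proof.
move=> pp' gx p'0.
pose E' := joint_event p p' (n + num_attached p') k l.+1 `&`
  [set w | boundary_in_cluster r w x].
pose E := joint_event p p' (n + num_attached p) k.+1 l `&`
  [set w | boundary_in_cluster r w x].
have mE' : measurable E'.
  apply: measurableI; first exact: measurable_joint_event.
  exact: measurable_boundary_in_cluster.
have AE : overlay p' x @^-1` E' = overlay p x @^-1` E.
  apply/seteqP; rewrite /preimage; split=> w /= [Jw Bw].
    have Bp := boundary_in_cluster_agree d1 gx (overlay_agree p' p x w) Bw.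
    split=> //; apply: (joint_event_swap d1 pp' gx (overlay_agree p p' x w) Bp _ _ Jw);
      exact: overlay_occurs.
  have Bp' := boundary_in_cluster_agree d1 gx (overlay_agree p p' x w) Bw.
  split=> //; rewrite joint_event_sym.
  apply: (joint_event_swap d1 (nesym pp') gx (overlay_agree p' p x w) Bp'
    (overlay_occurs p' x w) (overlay_occurs p x w)).
  by rewrite joint_event_sym.
have eA := @overlay_preimage _ _ _ _ p' x _ mE'.
(* an event forcing the boundary into the cluster is recovered from its
   overlaid version by adding the pattern and the ones on the neighbours *)
have insert p0 (F : set (Omega d hq)) : F `<=` [set w | boundary_in_cluster r w x] ->
    [set w | occurs p0 w x] `&` overlay p0 x @^-1` F `&` ones x =
    F `&` [set w | occurs p0 w x].
  move=> FB; apply/seteqP; split=> w.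
    by move=> [[pw Fw] Bw]; split=> //; move: Fw; rewrite /preimage /= overlay_id.
  move=> [Fw pw].
  have Bw : ones x w.
    move=> y /nbhd_box_at By; have := cluster_occ (FB _ Fw _ By).
    by rewrite subrKC.
  by split=> //; split=> //; rewrite /preimage /= overlay_id.
have := box_swap p eA p'0.
rewrite insert; last by move=> w [].
rewrite AE insert; last by move=> w [].
have cl p0 (J : set (Omega d hq)) : J `&` [set w | boundary_in_cluster r w x]
    `&` [set w | occurs p0 w x] = J `&` [set w | occurs_on_cluster p0 w x].
  by apply/seteqP; split=> w; [move=> [[? ?] ?]|move=> [? [? ?]]].
by rewrite !cl.
Qed.

End MarkovSwap.

(** * The exact identity between joint probabilities *)

(** Integrating the number of elements of a random set over an event on which
    that number is constant.  The series runs over the codes of the elements. *)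
Lemma expected_count (disp : measure_display) (T : measurableType disp)
    (R : realType) (P : probability T R) (U : countType) (S : T -> set U)
    (J : set T) (l : nat) : measurable J ->
  (forall u, measurable [set w | S w u]) ->
  (forall w, J w -> finite_set (S w) /\ #|` fset_set (S w)| = l) ->
  (l%:R%:E * P J = \sum_(0 <= i <oo)
     (if @pickle_inv U i is Some u then P (J `&` [set w | S w u]) else 0))%E.
Proof.
move=> mJ mS SJ.
pose F i : set T := if @pickle_inv U i is Some u then J `&` [set w | S w u] else set0.
have mF i : measurable (F i).
  by rewrite /F; case: pickle_inv => // u; exact: measurableI.
transitivity (\sum_(0 <= i <oo) P (F i))%E; last first.
  by apply: eq_eseriesr => i _; rewrite /F; case: pickle_inv => // ; exact: measure0.
transitivity (\sum_(0 <= i <oo) (\int[P]_w (\1_(F i) w)%:E))%E; last first.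
  by apply: eq_eseriesr => i _; rewrite integral_indic // setIT.
rewrite -integral_nneseries //; last first.
  by move=> i; apply/measurable_EFinP; exact: measurable_indic.
transitivity (\int[P]_w (l%:R%:E * (\1_J w)%:E))%E.
  by rewrite ge0_integralZl ?integral_indic ?setIT ?lee_fin //;
     apply/measurable_EFinP; exact: measurable_indic.
apply: eq_integral => w _.
rewrite nneseries_esumT; last by move=> i; rewrite lee_fin.
have [Jw|nJw] := pselect (J w); last first.
  rewrite indicE (memNset nJw) mule0 esum1 // => i _; rewrite indicE memNset //.
  by rewrite /F; case: pickle_inv => // u [].
have [fS cS] := SJ w Jw.
rewrite indicE (mem_set Jw) mule1.
pose I := @choice.pickle U @` S w.
transitivity (\esum_(i in I) (1%E : \bar R)).
  rewrite finite_card_sum; last exact: finite_image.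
  rewrite fset_set_image // card_imfset //= ?cS //.
rewrite esum_mkcond; apply: eq_esum => i _; rewrite indicE.
have [Fi|nFi] := pselect (F i w).
  rewrite (mem_set Fi) ifT //; apply/mem_set.
  move: Fi; rewrite /F; have := @pickle_invK U i; case: pickle_inv => //= u <- [_ Su].
  by exists u.
rewrite (memNset nFi) ifF //; apply: memNset => -[u Su ui]; apply: nFi.
by rewrite /F -ui pickleK_inv.
Qed.

Section JointProbability.
Context (d q : nat) (hq : (2 <= q)%N) (r : nat) (R : realType).
Context (P : probability (Omega d hq) R).
Hypothesis d1 : (1 < d)%N.
Hypothesis hinv : translation_invariant P.
Hypothesis hmarkov : boundary_markov P (one_state hq).

(** Both sides count, in expectation, the configurations with a marked place:
    on the left an occurrence of [p'], on the right the occurrence of [p] that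
    replaces it. *)
Lemma joint_prob_swap (p p' : pattern d hq r) n k l : p <> p' ->
  0 < fine (P (boxed_event p')) ->
  l.+1%:R * fine (P (joint_event p p' (n + num_attached p') k l.+1))
    * fine (P (boxed_event p)) =
  k.+1%:R * fine (P (joint_event p p' (n + num_attached p) k.+1 l))
    * fine (P (boxed_event p')).
Proof.
move=> pp' p'0.
set J' := joint_event _ _ _ k _; set J := joint_event _ _ _ k.+1 _.
have mJ' : measurable J' by exact: measurable_joint_event.
have mJ : measurable J by exact: measurable_joint_event.
have fP A : measurable A -> ((fine (P A))%:E = P A)%E.
  by move=> mA; rewrite fineK // fin_num_measure.
apply: EFin_inj; rewrite !EFinM (fP J' mJ') (fP J mJ).
have fin w m : cluster_size_eq m w -> finite_set (occ_cluster w 0).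
  by move=> /card_eq_IP[].
rewrite (@expected_count _ _ _ P _ (positions p') J') //; last 2 first.
- exact: measurable_positions.
- move=> w [/fin fC _ <-]; split=> //; exact: (finite_positions d1 _ fC).1.
rewrite (@expected_count _ _ _ P _ (positions p) J) //; last 2 first.
- exact: measurable_positions.
- move=> w [/fin fC <- _]; split=> //; exact: (finite_positions d1 _ fC).1.
rewrite muleC [RHS]muleC.
rewrite -!nneseriesZl; last 2 first.
- by move=> i _; case: pickle_inv.
- by move=> i _; case: pickle_inv.
apply: eq_eseriesr => i _; case: pickle_inv => [x|]; last by rewrite !mule0.
have [gx|ngx] := pselect (grid r x); last first.
  have E (p0 : pattern d hq r) K : K `&` [set w | positions p0 w x] = set0.
    by rewrite -subset0 => w [_ []].
  by rewrite !E measure0 !mule0.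
have E (p0 : pattern d hq r) K : K `&` [set w | positions p0 w x] =
    K `&` [set w | occurs_on_cluster p0 w x].
  by apply/seteqP; split=> w [? H]; split=> //; case: H.
have mO (p0 : pattern d hq r) K : measurable K ->
    measurable (K `&` [set w | occurs_on_cluster p0 w x]).
  by move=> mK; apply: measurableI => //; exact: measurable_occurs_on_cluster.
rewrite (E p') (E p) -(fP _ (mO p' J' mJ')) -(fP _ (mO p J mJ)).
rewrite muleC [RHS]muleC -[LHS]EFinM -[RHS]EFinM.
by congr EFin; exact: (joint_event_occurs_swap d1 hinv hmarkov).
Qed.

End JointProbability.

(** * Exponential bounds *)

Section GrowthRate.
Context (R : realType) (s : nat -> R) (mu : R).
Hypothesis s0 : forall n, 0 <= s n.
Hypothesis mu0 : 0 < mu.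
Hypothesis smu : (fun n : nat => s n `^ n%:R^-1) @ \oo --> mu.

Lemma powR_root (x : R) n : (0 < n)%N -> 0 <= x -> (x `^ n%:R^-1) ^+ n = x.
Proof.
move=> n0 x0; rewrite -powR_mulrn ?powR_ge0 // -powRrM mulVf ?powRr1 //.
by rewrite pnatr_eq0 -lt0n.
Qed.

Lemma root_rate_bounds (t : R) : 0 < t < 1 -> exists N, forall n, (N <= n)%N ->
  (mu * (1 - t)) ^+ n <= s n <= (mu * (1 + t)) ^+ n.
Proof.
move=> /andP[t0 t1].
have mt : 0 < mu * t by rewrite mulr_gt0.
have [N _ HN] : \forall n \near \oo, `|mu - s n `^ n%:R^-1| < mu * t.
  by move/cvgrPdist_lt : smu => /(_ _ mt).
exists N.+1 => n Nn; have n0 : (0 < n)%N by apply: leq_trans Nn.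
have := HN n (ltnW Nn); rewrite /= ltr_distl => /andP[lo hi].
rewrite -{1 2}(powR_root n0 (s0 n)); apply/andP; split.
  apply: lerXn2r; rewrite ?nnegrE ?powR_ge0 //; first by nra.
  by lra.
by apply: lerXn2r; rewrite ?nnegrE ?powR_ge0 //; nra.
Qed.

End GrowthRate.

Lemma bernoulli_ge (R : realFieldType) (x : R) n : -1 <= x ->
  1 + n%:R * x <= (1 + x) ^+ n.
Proof.
move=> x1; elim: n => [|n IH]; first by rewrite mul0r addr0 expr0.
rewrite exprS; apply: (@le_trans _ _ ((1 + x) * (1 + n%:R * x))); last first.
  by apply: ler_wpM2l => //; lra.
by rewrite -natr1; have := ler0n R n; nra.
Qed.

(** The swap identity is now used in isolation: [a] stands for the joint
    probabilities, [s n] for the probability of [|C| = n], and [b], [b'] for the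
    probabilities of the two boxed patterns. *)

Section TailBound.
Context (R : realType) (a : nat -> nat -> nat -> R) (s : nat -> R) (mu : R).
Context (c c' : nat) (b b' : R).
Hypothesis a0 : forall n k l, 0 <= a n k l.
Hypothesis as_ : forall n k l, a n k l <= s n.
Hypothesis s0 : forall n, 0 <= s n.
Hypothesis mu0 : 0 < mu.
Hypothesis smu : (fun n : nat => s n `^ n%:R^-1) @ \oo --> mu.
Hypothesis b0 : 0 <= b.
Hypothesis b'0 : 0 < b'.
Hypothesis swap : forall n k l,
  l.+1%:R * a (n + c') k l.+1 * b = k.+1%:R * a (n + c) k.+1 l * b'.

(** Along [m] swaps the numbers [l + m], ..., [l + 1] are at least [L] and
    [k + 1], ..., [k + m] are at most [K]. *)
Lemma iterated_swap (K L : nat) m n k l : (L <= l)%N -> (k + m <= K)%N ->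
  (L%:R * b) ^+ m * a (n + m * c') k (l + m) <=
  (K%:R * b') ^+ m * a (n + m * c) (k + m) l.
Proof.
elim: m => [|m IH] in n k l * => Ll kK.
  by rewrite !mul0n !addn0 !expr0.
have step n' k' l' : (L <= l')%N -> (k' < K)%N ->
    L%:R * b * a (n' + c') k' l'.+1 <= K%:R * b' * a (n' + c) k'.+1 l'.
  move=> Ll' kK'.
  apply: (@le_trans _ _ (l'.+1%:R * a (n' + c') k' l'.+1 * b)).
    rewrite mulrAC; apply: ler_wpM2r => //; apply: ler_wpM2r => //.
    by rewrite ler_nat ltnW.
  rewrite swap mulrAC; apply: ler_wpM2r => //; apply: ler_wpM2r; first exact: ltW.
  by rewrite ler_nat.
have Lb0 : 0 <= L%:R * b by rewrite mulr_ge0.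
have Kb0 : 0 <= K%:R * b' by rewrite mulr_ge0 // ltW.
rewrite exprS -mulrA.
have := IH (n + c')%N k l.+1 (leqW Ll) (leq_trans _ kK).
rewrite addnS => /(_ (leqnSn _)) H.
rewrite mulSn addnA addnS -addSn.
apply: le_trans (ler_wpM2l Lb0 H) _.
rewrite mulrCA [X in _ <= X * _]exprSr -[X in _ <= X]mulrA.
apply: ler_wpM2l; first exact: exprn_ge0.
rewrite (_ : n + c' + m * c = n + m * c + c')%N; last by lia.
rewrite (_ : n + m.+1 * c = n + m * c + c)%N; last by lia.
by apply: step => //; lia.
Qed.

Let gam := (mu ^+ c' * b) / (mu ^+ c * b').

(** With [m] swaps for [m = n / M], the hypothesis on [k] and [l] leaves
    [k + m <= kap * gam * (l - m)] for a constant [kap < 1], hence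
    [a n k l <= kap ^ m * mu ^ n] up to a factor [(1 + tau) ^ (2 n)].  The loss
    [tau] can be chosen after [M], so small that the gain [kap ^ m] wins. *)
Lemma one_sided_tail (eps : R) : 0 < eps -> exists K theta : R,
  [/\ 0 < K, 0 < theta < 1 & exists N, forall n k l, (N <= n)%N -> (l <= n)%N ->
    k%:R + eps * n%:R <= gam * l%:R -> a n k l <= K * theta ^+ n * s n].
Proof.
move=> e0.
have mc0 : 0 < mu ^+ c by exact: exprn_gt0.
have mc'0 : 0 < mu ^+ c' by exact: exprn_gt0.
have [bz|bnz] := eqVneq b 0.
  exists 1, 2^-1; split=> //; first by lra.
  exists 1%N => n k l n1 _.
  rewrite /gam bz mulr0 mul0r mul0r => H.
  have : (0 : R) < n%:R by rewrite ltr0n.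
  have := ler0n R k; nra.
have bp : 0 < b by rewrite lt_neqAle eq_sym bnz.
have g0 : 0 < gam by rewrite divr_gt0 // mulr_gt0.
(* half of eps pays for the factor kap, the other half for replacing k and l
   by k + m and l - m *)
pose kap := 1 - eps / (2 * (gam + eps)).
have ge0 : 0 < 2 * (gam + eps) by lra.
have kapE : (1 - kap) * (2 * (gam + eps)) = eps.
  by rewrite /kap opprB addrC subrK divfK // gt_eqF.
have kap1 : kap < 1 by nra.
have kap0 : 1/2 <= kap by nra.
have kapg : (1 - kap) * gam <= eps / 2 by nra.
(* the first condition keeps the size n - m c' + m c between n / 2 and 2 n, the
   second one makes m (1 + gam) at most eps n / 2 *)
have [M [M1 M2]] : exists M : nat, (2 * (c + c' + 1) <= M)%N /\
    2 * (1 + gam) <= eps * M%:R.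
  exists (maxn (2 * (c + c' + 1)) (Num.bound (2 * (1 + gam) / eps))).
  split; first exact: leq_maxl.
  rewrite -ler_pdivrMl // mulrC; apply: ltW.
  apply: (lt_le_trans (archi_boundP _)); last by rewrite ler_nat leq_maxr.
  by rewrite divr_ge0 // ?ltW //; lra.
have M0 : (0 < M)%N by clear -M1; lia.
have M0R : (0 : R) < M%:R by rewrite ltr0n.
have M1R : (1 : R) <= M%:R by rewrite ler1n.
(* sig is a substitute for the M-th root of kap, so that kap ^ m decays like
   sig ^ n *)
pose x := (1 - kap) / M%:R.
have xM : M%:R * x = 1 - kap by rewrite /x mulrC divfK // gt_eqF.
have x0 : 0 < x by rewrite divr_gt0 // subr_gt0.
have x1 : x <= 1/2 by nra.
pose sig := 1 - x.
have sigM : kap <= sig ^+ M.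
  have := @bernoulli_ge _ (- x) M; rewrite mulrN xM opprB addrC subrK; apply; lra.
(* chosen so that sig (1 + tau) ^ 2 <= (1 - tau) theta, see rate below *)
pose tau := x / 8; pose theta := 1 - x / 2.
have t01 : 0 < tau < 1 by rewrite /tau; lra.
have [N1 HN1] := root_rate_bounds s0 mu0 smu t01.
exists kap^-1, theta; split; [by rewrite invr_gt0; lra|by rewrite /theta; lra|].
exists (2 * N1 + 1)%N => n k l Nn ln H.
have n0 : (0 : R) < n%:R by rewrite ltr0n; clear -Nn; lia.
pose m := (n %/ M)%N.
have mM : (m * M <= n)%N by rewrite /m leq_trunc_div.
have nM : (n < m.+1 * M)%N by rewrite /m ltn_ceil.
have mMR : m%:R * M%:R <= n%:R :> R by rewrite -natrM ler_nat.
have m0R : (0 : R) <= m%:R by [].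
have gm : gam * m%:R + m%:R <= eps / 2 * n%:R.
  have : m%:R * (2 * (1 + gam)) <= m%:R * (eps * M%:R) by rewrite ler_wpM2l.
  nra.
have k0R : (0 : R) <= k%:R by [].
have ml : (m < l)%N.
  rewrite -(ltr_nat R) -(ltr_pM2l g0); nra.
have half e : (e <= c + c')%N -> (2 * (m * e) <= n)%N.
  move=> ec; apply: leq_trans mM; rewrite mulnCA leq_mul2l; apply/orP; right.
  by apply: leq_trans M1; rewrite leq_mul2l /= (leq_trans ec) // leq_addr.
have mc' : (2 * (m * c') <= n)%N by apply: half; rewrite leq_addl.
have mc : (2 * (m * c) <= n)%N by apply: half; rewrite leq_addr.
have lE : (l = (l - m) + m)%N by rewrite subnK // ltnW.
have nE : (n = (n - m * c') + m * c')%N.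
  by rewrite subnK //; clear -mc'; lia.
set l0 := (l - m)%N in lE; set n0' := (n - m * c')%N in nE.
have l0R : (0 : R) < l0%:R by rewrite ltr0n subn_gt0.
have lR : l%:R = l0%:R + m%:R :> R by rewrite -natrD -lE.
have km : (k + m)%:R <= kap * gam * l0%:R.
  have ln' : l0%:R <= n%:R :> R by rewrite ler_nat (leq_trans _ ln) // leq_subr.
  rewrite natrD; move: H; rewrite lR.
  have : (1 - kap) * gam * l0%:R <= eps / 2 * n%:R.
    apply: (@le_trans _ _ ((1 - kap) * gam * n%:R)); last first.
      by apply: ler_wpM2r => //; exact: ltW.
    by apply: ler_wpM2l => //; apply: mulr_ge0; [lra|exact: ltW].
  nra.
pose N := (n0' + m * c)%N.
have := @iterated_swap (k + m) l0 m n0' k l0 (leqnn _) (leqnn _).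
rewrite -nE -lE -/N => It.
(* the powers of mu in gam are exactly those that compensate the change of
   size from n to N *)
have muN : ((kap * gam * b') / b) ^+ m * mu ^+ N = kap ^+ m * mu ^+ n.
  have -> : kap * gam * b' / b = kap * (mu ^+ c' / mu ^+ c).
    by rewrite /gam; field; rewrite !gt_eqF.
  rewrite /N [in RHS]nE !exprMn !exprD exprVn -!exprM [(c * m)%N]mulnC [(c' * m)%N]mulnC.
  by field; rewrite gt_eqF // exprn_gt0.
have kp : 0 < kap by lra.
have X0 : 0 <= kap * gam * b' / b.
  by apply: divr_ge0; [apply: mulr_ge0; [apply: mulr_ge0|]|]; exact: ltW.
have step1 : a n k l <= ((kap * gam * b') / b) ^+ m * s N.
  have lb : 0 < (l0%:R * b) ^+ m by rewrite exprn_gt0 // mulr_gt0.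
  rewrite -(ler_pM2l lb); apply: le_trans It _.
  rewrite mulrA -exprMn; apply: ler_pM => //.
    by rewrite exprn_ge0 // mulr_ge0 // ltW.
  apply: lerXn2r; rewrite ?nnegrE.
  - by rewrite mulr_ge0 // ltW.
  - by rewrite mulr_ge0 // mulr_ge0 // ltW.
  have -> : l0%:R * b * (kap * gam * b' / b) = kap * gam * l0%:R * b'.
    by field; rewrite gt_eqF.
  by rewrite ler_pM2r.
have NN : (N1 <= N)%N by rewrite /N /n0'; clear -mc' Nn; lia.
have N2 : (N <= 2 * n)%N by rewrite /N /n0'; clear -mc; lia.
have /andP[_ sN] := HN1 N NN.
have /andP[sn _] : (mu * (1 - tau)) ^+ n <= s n <= (mu * (1 + tau)) ^+ n.
  by apply: HN1; clear -Nn; lia.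
have t0 : 0 < tau by case/andP: t01.
have sig0 : 0 <= sig by rewrite /sig; lra.
have th0 : 0 <= theta by rewrite /theta; lra.
(* the factor kap^-1 accounts for the rounding in m = n / M *)
have kapm : kap ^+ m <= kap^-1 * sig ^+ n.
  rewrite -(ler_pM2l kp) -exprS mulrA divff ?gt_eqF // mul1r.
  apply: (@le_trans _ _ ((sig ^+ M) ^+ m.+1)).
    by apply: lerXn2r; rewrite ?nnegrE ?exprn_ge0 // ltW.
  rewrite -exprM; apply: ler_wiXn2l; rewrite ?sig0 //; first by rewrite /sig; lra.
  by rewrite mulnC ltnW.
have rate : sig * (1 + tau) ^+ 2 <= (1 - tau) * theta.
  by rewrite /sig /theta /tau; nra.
apply: (le_trans step1).
apply: (@le_trans _ _ (kap ^+ m * mu ^+ n * (1 + tau) ^+ N)).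
  rewrite -muN -[X in _ <= X]mulrA -exprMn; apply: ler_wpM2l => //.
  exact: exprn_ge0.
apply: (@le_trans _ _ (kap^-1 * sig ^+ n * mu ^+ n * ((1 + tau) ^+ 2) ^+ n)).
  apply: ler_pM.
  - by rewrite mulr_ge0 // exprn_ge0 // ltW.
  - by apply: exprn_ge0; lra.
  - by rewrite ler_wpM2r // exprn_ge0 // ltW.
  - by rewrite -exprM; apply: ler_weXn2l => //; lra.
have -> : kap^-1 * sig ^+ n * mu ^+ n * ((1 + tau) ^+ 2) ^+ n =
    kap^-1 * mu ^+ n * (sig * (1 + tau) ^+ 2) ^+ n.
  by rewrite [in RHS]exprMn mulrA -!(mulrAC _ (mu ^+ n)).
apply: (@le_trans _ _ (kap^-1 * mu ^+ n * ((1 - tau) * theta) ^+ n)).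
  apply: ler_wpM2l; first by rewrite mulr_ge0 ?invr_ge0 ?exprn_ge0 // ltW.
  apply: lerXn2r; rewrite ?nnegrE //.
    by apply: mulr_ge0 => //; apply: exprn_ge0; lra.
  by apply: mulr_ge0 => //; rewrite /tau; lra.
have -> : kap^-1 * mu ^+ n * ((1 - tau) * theta) ^+ n =
    kap^-1 * theta ^+ n * (mu * (1 - tau)) ^+ n.
  by rewrite !exprMn [_ * theta ^+ n]mulrC mulrACA.
by apply: ler_wpM2l => //; rewrite mulr_ge0 ?invr_ge0 ?exprn_ge0 // ltW.
Qed.

End TailBound.

(** * Two-sided deviations and conclusion *)

Section Conclusion.

Lemma union_bound (disp : measure_display) (T : measurableType disp)
    (R : realType) (P : probability T R) (N : nat) (G : nat -> set T) (e : R) :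
  (forall i, measurable (G i)) -> (forall i, (i < N)%N -> fine (P (G i)) <= e) ->
  fine (P (\bigcup_(i < N) G i)) <= N%:R * e.
Proof.
move=> mG Ge; rewrite bigcup_mkord -lee_fin fineK; last first.
  by apply: fin_num_measure; exact: bigsetU_measurable.
apply: le_trans (Boole_inequality _ _) _ => [i _//|].
apply: (@le_trans _ _ (\sum_(i < N) e%:E)%E); last first.
  by rewrite sumEFin lee_fin sumr_const card_ord mulr_natl.
apply: lee_sum => i _.
by have := Ge i (ltn_ord i); rewrite -lee_fin fineK // fin_num_measure.
Qed.

(** With [theta (1 + h) ^ 3 < 1], Bernoulli's inequality bounds
    [(n + 1) ^ 3] by a multiple of [(1 + h) ^ (3 n)], which leaves one spare
    factor [n + 1] to absorb [K]. *)
Lemma poly_mul_geometric (R : realType) (K theta : R) : 0 < theta < 1 ->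
  exists2 rho, 0 < rho < 1 & exists N, forall n, (N <= n)%N ->
    n.+1%:R * (n.+1%:R * (K * theta ^+ n)) <= rho ^+ n.
Proof.
move=> /andP[t0 t1]; pose h := (1 - theta) / 14.
have h0 : 0 < h by rewrite /h; lra.
have h1 : h <= 1 by rewrite /h; lra.
have rho1 : theta * (1 + h) ^+ 3 <= (1 + theta) / 2.
  have : (1 + h) ^+ 3 <= 1 + 7 * h by nra.
  move=> /(ler_wpM2l (ltW t0)); rewrite /h; nra.
exists ((1 + theta) / 2); first lra.
have h30 : 0 < h ^+ 3 by exact: exprn_gt0.
exists (Num.bound (`|K| / h ^+ 3)) => n Nn.
have Kn : K <= h ^+ 3 * n.+1%:R.
  apply: le_trans (ler_norm K) _; rewrite -ler_pdivrMl // mulrC; apply: ltW.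
  apply: (lt_le_trans (archi_boundP _)); first by rewrite divr_ge0 // ltW.
  by rewrite ler_nat leqW.
have hn : h * n.+1%:R <= (1 + h) ^+ n.
  have : 1 + n%:R * h <= (1 + h) ^+ n by apply: bernoulli_ge; lra.
  by apply: le_trans; rewrite -natr1; lra.
have Kpow : n.+1%:R * n.+1%:R * K <= ((1 + h) ^+ 3) ^+ n.
  rewrite -exprM mulnC exprM.
  apply: (@le_trans _ _ ((h * n.+1%:R) ^+ 3)); last first.
    apply: lerXn2r hn; rewrite nnegrE; first by rewrite mulr_ge0 // ltW.
    by apply: exprn_ge0; lra.
  have n0 : (0 : R) <= n.+1%:R by [].
  apply: le_trans (ler_wpM2l (mulr_ge0 n0 n0) Kn) _.
  by rewrite mulrCA -expr2 -exprSr -exprMn.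
rewrite !mulrA mulrC; apply: (@le_trans _ _ ((theta * (1 + h) ^+ 3) ^+ n)).
  by rewrite exprMn ler_wpM2l // exprn_ge0 // ltW.
apply: lerXn2r => //; rewrite nnegrE; last lra.
by apply: mulr_ge0; [exact: ltW|apply: exprn_ge0; lra].
Qed.

Lemma limn_esup_lt1 (R : realType) (u : nat -> R) (rho : R) (N : nat) :
  rho < 1 -> (forall n, (N <= n)%N -> u n <= rho) ->
  (limn_esup (fun n => (u n)%:E) < 1)%E.
Proof.
move=> r1 ur; apply: (@le_lt_trans _ _ rho%:E); last by rewrite lte_fin.
apply: ge_ereal_inf; exists (ereal_sup [set (u n)%:E | n in [set n | (N <= n)%N]]).
  by exists [set n | (N <= n)%N] => //; exists N.
by apply: ge_ereal_sup => _ [n Nn <-]; rewrite lee_fin ur.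
Qed.

Context (R : realType) (d q : nat) (hq : (2 <= q)%N).
Context (P : probability (Omega d hq) R) (r : nat) (mu : R).
Implicit Types p : pattern d hq r.
Hypothesis d1 : (1 < d)%N.
Hypothesis hinv : translation_invariant P.
Hypothesis hmarkov : boundary_markov P (one_state hq).
Hypothesis hmu : exponential_tail P mu.

Let s n := fine (P (cluster_size_eq n)).

Lemma joint_le_size p p' n k l : fine (P (joint_event p p' n k l)) <= s n.
Proof.
apply: probability_fine_le; [exact: measurable_joint_event| |by move=> w []].
exact: measurable_cluster_size.
Qed.

Lemma joint_tail p p' (eps : R) : p <> p' -> 0 < fine (P (boxed_event p')) ->
  0 < eps -> exists K theta : R,
  [/\ 0 < K, 0 < theta < 1 & exists N, forall n k l, (N <= n)%N -> (l <= n)%N ->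
    k%:R + eps * n%:R <= gamma_ratio P mu p p' * l%:R ->
    fine (P (joint_event p p' n k l)) <= K * theta ^+ n * s n].
Proof.
move=> pp' p'0 e0; have [/andP[mu0 _] smu _] := hmu.
apply: (@one_sided_tail R (fun n k l => fine (P (joint_event p p' n k l))) s mu
  (num_attached p) (num_attached p') (fine (P (boxed_event p)))
  (fine (P (boxed_event p')))) => //.
- by move=> n k l; exact: fine_ge0.
- by move=> n k l; exact: joint_le_size.
- by move=> n; exact: fine_ge0.
- exact: fine_ge0.
- by move=> n k l; exact: joint_prob_swap.
Qed.

(** If [p] has no mass, one swap back shows that it almost surely does not
    occur on a finite cluster. *)
Lemma joint_null p p' n k l : p <> p' -> 0 < fine (P (boxed_event p')) ->
  fine (P (boxed_event p)) = 0 -> (num_attached p <= n)%N ->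
  fine (P (joint_event p p' n k.+1 l)) = 0.
Proof.
move=> pp' p'0 pz cn.
have := joint_prob_swap d1 hinv hmarkov (n - num_attached p) k l pp' p'0.
rewrite pz mulr0 subnK // => /esym/eqP.
by rewrite !mulf_eq0 (gt_eqF p'0) pnatr_eq0 orbF /= => /eqP.
Qed.

(** A deviation with [N_p] too large is one with [N_p'] too small relative to
    the inverse ratio, provided that [p] has positive mass; otherwise [gamma = 0]
    and [joint_null] applies. *)
Lemma joint_two_sided_tail p p' (eps : R) : p <> p' ->
  0 < fine (P (boxed_event p')) -> 0 < eps -> exists K theta : R,
  [/\ 0 < K, 0 < theta < 1 & exists N, forall n k l, (N <= n)%N ->
    (k <= n)%N -> (l <= n)%N ->
    eps * n%:R <= `|k%:R - gamma_ratio P mu p p' * l%:R| ->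
    fine (P (joint_event p p' n k l)) <= K * theta ^+ n * s n].
Proof.
move=> pp' p'0 e0; have [/andP[mu0 _] _ _] := hmu.
have s0 n : 0 <= s n by exact: fine_ge0.
have [K1 [th1 [K10 /andP[th10 th11] [N1 H1]]]] := joint_tail pp' p'0 e0.
set g := gamma_ratio P mu p p' in H1 *.
have g0 : 0 <= g.
  by rewrite /g divr_ge0 // mulr_ge0 ?fine_ge0 // exprn_ge0 // ltW.
have [K2 [th2 [K20 /andP[th20 th21] [N2 H2]]]] : exists K theta : R,
    [/\ 0 < K, 0 < theta < 1 & exists N, forall n k l, (N <= n)%N -> (k <= n)%N ->
    g * l%:R + eps * n%:R <= k%:R ->
    fine (P (joint_event p p' n k l)) <= K * theta ^+ n * s n].
  have [pz|pn0] := eqVneq (fine (P (boxed_event p))) 0.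
    exists 1, 2^-1; split=> //; first lra.
    exists (num_attached p).+1 => n k l nN _ H.
    have k0 : (0 < k)%N.
      have n0 : (0 : R) < n%:R by rewrite ltr0n (leq_trans _ nN).
      have l0 : (0 : R) <= l%:R by [].
      by rewrite -(ltr_nat R); nra.
    rewrite -(prednK k0) joint_null //; last exact: ltnW.
    by rewrite mulr_ge0 // mul1r exprn_ge0.
  have p0 : 0 < fine (P (boxed_event p)) by rewrite lt_neqAle eq_sym pn0 fine_ge0.
  have gp : 0 < g by rewrite /g divr_gt0 // mulr_gt0 // exprn_gt0.
  have e0' : 0 < eps / g by rewrite divr_gt0.
  have [K [th [K0 th0 [N H]]]] := joint_tail (nesym pp') p0 e0'.
  exists K, th; split=> //; exists N => n k l nN kn kl.
  rewrite joint_event_sym; apply: H => //.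
  have -> : gamma_ratio P mu p' p = g^-1 by rewrite /g /gamma_ratio invf_div.
  rewrite -(ler_pM2l gp) mulrDr !mulrA mulfV ?gt_eqF // mul1r.
  by rewrite [g * eps]mulrC mulfK ?gt_eqF.
exists (K1 + K2), (Num.max th1 th2); split; first by rewrite addr_gt0.
  by rewrite lt_max th10 gt_max th11 th21.
exists (maxn N1 N2) => n k l; rewrite geq_max => /andP[n1 n2] kn ln.
have pow K th : 0 < K -> 0 < th -> K <= K1 + K2 -> th <= Num.max th1 th2 ->
    K * th ^+ n * s n <= (K1 + K2) * Num.max th1 th2 ^+ n * s n.
  move=> K0 th0 KK thth; apply: ler_wpM2r => //; apply: ler_pM => //.
  - exact: ltW.
  - by rewrite exprn_ge0 // ltW.
  - by apply: lerXn2r; rewrite ?nnegrE // ltW // (lt_le_trans th0).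
case: ger0P => [c1|c2] H.
  apply: le_trans (pow _ _ K20 th20 _ _); last 2 first.
  - by rewrite lerDr ltW.
  - by rewrite le_max lexx orbT.
  by apply: H2 => //; move: H; lra.
apply: le_trans (pow _ _ K10 th10 _ _); last 2 first.
- by rewrite lerDl ltW.
- by rewrite le_max lexx.
by apply: H1 => //; move: H; lra.
Qed.

Lemma deviation_decomposition p p' (eps g : R) n :
  [set w | eps * n%:R <= `|(num_occ p w)%:R - g * (num_occ p' w)%:R|] `&`
    cluster_size_eq n =
  \bigcup_(k < n.+1) \bigcup_(l < n.+1)
    (if eps * n%:R <= `|k%:R - g * l%:R| then joint_event p p' n k l else set0).
Proof.
apply/seteqP; split=> [w [dev Cn]|w [k _ [l _]]]; last first.
  by case: ifP => // dev [Cn kE lE]; split=> //=; rewrite kE lE.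
have /card_eq_IP[fC cC] := Cn.
have le_n p0 : (num_occ p0 w < n.+1)%N.
  by rewrite ltnS -[X in (_ <= X)%N]cC (finite_positions d1 p0 fC).2.
exists (num_occ p w); first exact: le_n.
exists (num_occ p' w); first exact: le_n.
by rewrite dev; split.
Qed.

End Conclusion.

Theorem theorem1p8 (R : realType) (d q : nat) (hd : (2 <= d)%N)
    (hq : (2 <= q)%N) (P : probability (Omega d hq) R)
    (hinv : translation_invariant P)
    (r : nat) (hr : (1 <= r)%N) (p p' : pattern d hq r) (hpp' : p <> p')
    (hp' : (0 < P (boxed_event p'))%E)
    (hmarkov : boundary_markov P (one_state hq))
    (mu : R) (hmu : exponential_tail P mu)
    (eps : R) (heps : 0 < eps) :
  (limn_esup (fun n : nat =>
     (condprob P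
        [set w | eps * n%:R <=
           `| (num_occ p w)%:R - gamma_ratio P mu p p' * (num_occ p' w)%:R |]
        (cluster_size_eq (d := d) (hq := hq) n) `^ n%:R^-1)%:E) < 1)%E.
Proof.
have p'0 : 0 < fine (P (boxed_event p')).
  apply: fine_gt0; rewrite hp' ltey_eq fin_num_measure //.
  exact: measurable_boxed_event.
have [K [th [K0 th01 [N H]]]] := joint_two_sided_tail hd hinv hmarkov hmu hpp' p'0 heps.
have [rho rho01 [N' H']] := poly_mul_geometric K th01.
have /andP[rho0 rho1] := rho01.
have /andP[th0 _] := th01.
apply: (@limn_esup_lt1 _ _ rho (maxn N N').+1 rho1) => n nN.
have [nN1 nN2] : (N <= n)%N /\ (N' <= n)%N by lia.
have n0 : (0 < n)%N by lia.
have rhon : 0 <= rho ^+ n by rewrite exprn_ge0 // ltW.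
set q0 := condprob _ _ _.
have q0ge : 0 <= q0 by rewrite divr_ge0 // fine_ge0.
suff qn : q0 <= rho ^+ n.
  have rhoE : (rho ^+ n) `^ n%:R^-1 = rho.
    by rewrite -powR_mulrn ?ltW // -powRrM mulfV ?powRr1 ?ltW // pnatr_eq0 -lt0n.
  by rewrite -rhoE; apply: ge0_ler_powR.
rewrite /q0 /condprob deviation_decomposition //.
set s := fine (P (cluster_size_eq n)).
have s0 : 0 <= s by exact: fine_ge0.
(* a null conditioning event gives conditional probability 0 *)
have [->|sn0] := eqVneq s 0; first by rewrite invr0 mulr0.
rewrite ler_pdivrMr; last by rewrite lt_neqAle eq_sym sn0.
apply: le_trans (ler_wpM2r s0 (H' n nN2)); rewrite -!mulrA.
have mJ k l : measurable (if eps * n%:R <= `|k%:R - gamma_ratio P mu p p' * l%:R|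
    then joint_event p p' n k l else set0).
  by case: ifP => // _; exact: measurable_joint_event.
apply: union_bound => [k|k kn].
  by rewrite bigcup_mkord; exact: bigsetU_measurable.
apply: union_bound => [l|l ln]; first exact: mJ.
rewrite mulrA; case: ifP => [dev|_]; first exact: H.
by rewrite measure0 /= !mulr_ge0 // ?exprn_ge0 // ltW.
Qed.
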